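(* For all integers $J\ge 0$ and $N\ge 0$, $$MO(2,9J+4;27N+9)\equiv 0\pmod 3\qquad\text{and}\qquad MO(2,9J+7;27N)\equiv 0\pmod 3.$$
   Context: For an integer $a$ and a nonnegative integer $t$, define $MO(a,t;n)$ by the formal power series identity $$\sum_{n\ge 0}MO(a,t;n)\,q^n=\sum_{1\le n_1<n_2<\cdots<n_t}\frac{q^{n_1+n_2+\cdots+n_t}}{\prod_{k=1}^t(1+aq^{n_k}+q^{2n_k})},$$ where each factor $1/(1+aq^{m}+q^{2m})$ is expanded as a power series in $q$ with integer coefficients. *)

(* Defs.v *)
From mathcomp Require Import all_boot all_order all_algebra.

Set Implicit Arguments.
Unset Strict Implicit.
Unset Printing Implicit Defensive.

Import GRing.Theory.
Local Open Scope ring_scope.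

(* An element of Z[[q]] is given by its sequence of coefficients. *)
Definition fps := nat -> int.

Definition fps_of_poly (p : {poly int}) : fps := fun n => p`_n.

Definition fps_mul (f g : fps) : fps :=
  fun n => \sum_(i < n.+1) f i * g (n - i)%N.

(* Coefficients 0, ..., n of 1 / f, solved for recursively; this presupposes
   that the constant coefficient of f is 1, as in fps_mulV below. *)
Fixpoint fps_inv_seq (f : fps) (n : nat) : seq int :=
  if n is n'.+1 then
    let s := fps_inv_seq f n' in
    rcons s (- \sum_(i < n'.+1) f i.+1 * s`_(n' - i))
  else [:: 1].

Definition fps_inv (f : fps) : fps := fun n => (fps_inv_seq f n)`_n.

Lemma size_fps_inv_seq f n : size (fps_inv_seq f n) = n.+1.
Proof. by elim: n => //= n IHn; rewrite size_rcons IHn. Qed.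

Lemma nth_fps_inv_seq f n i :
  (i <= n)%N -> (fps_inv_seq f n)`_i = fps_inv f i.
Proof.
elim: n => [|n IHn]; first by rewrite leqn0 => /eqP->.
rewrite leq_eqVlt => /predU1P[-> //|lt_i].
by rewrite /= nth_rcons size_fps_inv_seq lt_i IHn.
Qed.

Lemma fps_mulV f n : f 0%N = 1 -> fps_mul f (fps_inv f) n = (n == 0%N)%:R.
Proof.
move=> f0; rewrite /fps_mul big_ord_recl f0 mul1r subn0.
case: n => [|n]; first by rewrite big_ord0 addr0.
rewrite {1}/fps_inv /= nth_rcons size_fps_inv_seq ltnn eqxx.
rewrite addrC; apply/eqP; rewrite subr_eq0; apply/eqP.
apply: eq_bigr => i _; rewrite /bump /= add1n subSS.
by rewrite nth_fps_inv_seq ?leq_subr.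
Qed.

Definition MO_den (a : int) (s : seq nat) : {poly int} :=
  \prod_(m <- s) (1 + a *: 'X^m + 'X^(2 * m)).

Definition MO_term (a : int) (s : seq nat) : fps :=
  fps_mul (fps_of_poly 'X^(\sum_(m <- s) m)) (fps_inv (fps_of_poly (MO_den a s))).

(* The part of the defining sum with 1 <= n_1 < ... < n_t <= M; the condition
   path ltn 0 [:: n_1; ...; n_t] reads 0 < n_1 < ... < n_t. *)
Definition MO_upto (a : int) (t M : nat) : fps :=
  fun n => \sum_(s : t.-tuple 'I_M.+1 | path ltn 0 (map val s))
             MO_term a (map val s) n.

(* Terms with n_t > n are divisible by q^(n+1), so the coefficient of q^n in the
   infinite sum is already reached at M = n: see MO_uptoE. *)
Definition MO (a : int) (t n : nat) : int := MO_upto a t n n.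

Lemma MO_den_coef0 a s : path ltn 0 s -> (MO_den a s)`_0 = 1.
Proof.
rewrite path_sortedE; last exact: ltn_trans.
case/andP=> s_gt0 _; rewrite -horner_coef0 /MO_den horner_prod.
rewrite big_seq big1 // => m /(allP s_gt0) m_gt0.
by rewrite !hornerE !expr0n muln_eq0 /= (gtn_eqF m_gt0) mulr0 !addr0.
Qed.

Lemma MO_term_small a s n m : m \in s -> (n < m)%N -> MO_term a s n = 0.
Proof.
move=> sm lt_nm; rewrite /MO_term /fps_mul big1 // => i _.
rewrite /fps_of_poly coefXn ltn_eqF ?mul0r //.
have le_i: (i <= n)%N by rewrite -ltnS.
apply: leq_ltn_trans le_i (leq_trans lt_nm _).
by rewrite (big_rem m) //= leq_addr.
Qed.

Lemma MO_uptoE a t M n : (n <= M)%N -> MO_upto a t M n = MO a t n.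
Proof.
move=> le_nM; rewrite /MO /MO_upto.
pose small (s : t.-tuple 'I_M.+1) := all (fun m : 'I_M.+1 => (m <= n)%N) s.
rewrite (bigID small) /= addrC big1 ?add0r => [|s /andP[_ /allPn[m sm lt_nm]]];
  last by apply: (@MO_term_small _ _ _ (val m)); rewrite ?map_f // ltnNge.
pose f (i : 'I_M.+1) : 'I_n.+1 := inord i.
pose g (i : 'I_n.+1) : 'I_M.+1 := inord i.
have fP (s : t.-tuple 'I_M.+1) : small s -> map val (map f s) = map val s.
  move=> /allP ss; rewrite -map_comp; apply/eq_in_map => i /ss le_in /=.
  by rewrite inordK.
have gP (s : t.-tuple 'I_n.+1) : map val (map g s) = map val s.
  rewrite -map_comp; apply/eq_map => i /=; rewrite inordK //.
  exact: leq_trans (ltn_ord i) _.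
rewrite (reindex_onto (fun s : t.-tuple 'I_n.+1 => [tuple of map g s])
                      (fun s : t.-tuple 'I_M.+1 => [tuple of map f s])) /=; last first.
  move=> s /andP[_ ss]; apply/val_inj/(inj_map val_inj) => /=.
  by have /= -> := gP [tuple of map f s]; apply: fP.
apply: eq_big => [s|s _]; last by rewrite gP.
rewrite gP; have ss: small [tuple of map g s].
  apply/allP => _ /mapP[i _ ->]; rewrite inordK; first by rewrite -ltnS.
  exact: leq_trans (ltn_ord i) _.
rewrite ss andbT; have -> : [tuple of map f (map g s)] = s; last first.
  by rewrite eqxx andbT.
apply/val_inj/(inj_map val_inj) => /=.
by have /= -> := fP _ ss; apply: gP.
Qed.

(* Main.v *)
Require Import Defs.
From mathcomp Require Import all_boot all_order all_algebra.
From mathcomp Require Import finfield ring zify.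

(**
With T_k = k(k+1)/2 and psi(q) = sum_k q^(T_k), the Jacobi triple product gives
psi(q) * sum_n MO(2,t;n) q^n = sum_k binomial(k+t,2t) q^(T_k): expanding in x,
prod_m (1-q^m)(1+(2+x)q^m+q^(2m)) = sum_k P_k(x) q^(T_k), where
P_k(x) = sum_t binomial(k+t,2t) x^t; the value at x = 0 is psi itself.  A
finite version of this identity, with explicit coefficients, is proved by
induction on the number of factors and used modulo q^(M+1).

By Lucas, for t = 9J+4 (resp. 9J+7) the numerator is modulo 3 supported on
exponents congruent to 10 (resp. 1) modulo 27.  Over F_3, 1/psi equals
psi^26(q)/psi(q^27), so it remains to see that psi^26 has no exponent congruent
to 26 modulo 27.  As psi(q) = A(q^3) + q psi(q^9), extracting the exponents
3i+2 turns psi^(3e+2) into psi^(e+6); this sends psi^26 to psi^14, to psi^10,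
and psi^10 = psi(q) psi(q^3)^3 has no exponent congruent to 2 modulo 3.
*)

Set Implicit Arguments.
Unset Strict Implicit.
Unset Printing Implicit Defensive.

Import GRing.Theory.
Local Open Scope ring_scope.

(** * The finite form of the Jacobi triple product *)

Lemma triS k : 'C(k.+2, 2) = ('C(k.+1, 2) + k.+1)%N.
Proof. by rewrite binS bin1. Qed.

Section FiniteTripleProduct.
Variables (R : comNzRingType) (q x : R).

Definition qprod (a b : nat) : R := \prod_(a <= i < b) (1 - q ^+ i).

Lemma qprod_nil a b : (b <= a)%N -> qprod a b = 1.
Proof. by move=> le_ba; rewrite /qprod big_geq. Qed.

Lemma qprodSl a b : (a < b)%N -> qprod a b = (1 - q ^+ a) * qprod a.+1 b.
Proof. by move=> lt_ab; rewrite /qprod big_ltn. Qed.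

Lemma qprodSr a b : (a <= b)%N -> qprod a b.+1 = qprod a b * (1 - q ^+ b).
Proof. by move=> le_ab; rewrite /qprod big_nat_recr. Qed.

Lemma qprod1 a : qprod a a.+1 = 1 - q ^+ a.
Proof. by rewrite qprodSl // qprod_nil // mulr1. Qed.

Lemma qprod0 b : qprod 0 b.+1 = 0.
Proof. by rewrite qprodSl // expr0 subrr mul0r. Qed.

(* [(q)_M] times the q-binomial coefficient [2M+1 choose M-k], where [(q)_M] is
   [qprod 1 M.+1]; for [k > M] the truncated subtraction puts the factor
   [1 - q^0 = 0] in the first product, so the value is [0] as it should be. *)
Definition jcoef (M k : nat) : R :=
  qprod (M.+1 - k) M.+1 * qprod (M + k).+2 (2 * M).+2.

Lemma jcoef_gt M k : (M < k)%N -> jcoef M k = 0.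
Proof.
move=> lt_Mk; rewrite /jcoef (_ : M.+1 - k = 0)%N ?qprod0 ?mul0r //.
by apply/eqP; rewrite subn_eq0.
Qed.

Lemma jcoef_diag M : jcoef M M = qprod 1 M.+1.
Proof. by rewrite /jcoef subSnn [X in _ * X]qprod_nil ?mulr1; last by lia. Qed.

(** Boundary case of the recurrence below. As cosine is even, [coscheb] continued to index -1 takes
    its value at 0, so index 0 is its own lower neighbour and contributes the middle term
    [q ^+ M.+1]. *)
Lemma jcoef_rec0 M :
  jcoef M.+1 0 = (1 - q ^+ M.+1) *
    ((1 + q ^+ M.+1 + q ^+ (2 * M.+1)) * jcoef M 0 + q ^+ M.+2 * jcoef M 1).
Proof.
case: M => [|M].
  rewrite (@jcoef_gt 0 1) // mulr0 addr0 /jcoef.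
  have -> : qprod (1 + 0).+2 (2 * 1).+2 = 1 - q ^+ 3.
    exact: qprod1.
  by rewrite !qprod_nil //; ring.
rewrite /jcoef !addn0 !addn1 !subn0 subn1 /=.
rewrite (@qprodSl M.+1 M.+2) // !(@qprod_nil M.+3 M.+3) // !(@qprod_nil M.+2 M.+2) //.
rewrite (@qprodSl M.+3); last by lia.
rewrite (_ : 2 * M.+2 = (2 * M.+1).+2)%N; last by lia.
do 2 (rewrite (@qprodSr M.+4); last by lia).
rewrite (_ : 2 * M.+1 = M.+1 + M.+1)%N; last by lia.
by rewrite -!addnS !exprS !exprD !exprS; set W := qprod _ _; ring.
Qed.

(** Effect of the factor of index [m] on the coefficient of [coscheb k.+1], with the triangular
    power of [q] divided out. The neighbours [k] and [k.+2] enter through (2+x) c_j = c_(j+1) +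
    c_(j-1). The parameter [a] stands for [m - k.+1], so that no exponent contains a subtraction. *)
Lemma jcoef_recS a k :
  let m := (k + a).+1 in
  jcoef m k.+1 = (1 - q ^+ m) *
    ((1 + q ^+ (2 * m)) * jcoef (k + a) k.+1 + q ^+ a * jcoef (k + a) k
     + q ^+ (m + k.+2) * jcoef (k + a) k.+2).
Proof.
(* For [a] equal to 0 or 1, some coefficients on the right have an index beyond [k + a] and vanish;
   otherwise all four share the factors [W] and [Z] below. *)
case: a => [|[|a]] /=.
- rewrite addn0 (@jcoef_gt k k.+1) // (@jcoef_gt k k.+2) //.
  rewrite !jcoef_diag (@qprodSr 1) //; ring.
- rewrite addn1 (@jcoef_gt _ k.+2) // /jcoef.
  rewrite (_ : k.+3 - k.+1 = 2)%N; last by lia.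
  rewrite (_ : k.+2 - k.+1 = 1)%N; last by lia.
  rewrite (_ : k.+2 - k = 2)%N; last by lia.
  rewrite (@qprod_nil (k.+1 + k.+1).+2); last by lia.
  rewrite (@qprodSr 2) // (@qprodSl 1) //.
  rewrite (_ : 2 * k.+2 = (2 * k.+1).+2)%N; last by lia.
  rewrite (_ : (k.+2 + k.+1).+2 = (2 * k.+1).+3)%N; last by lia.
  rewrite (_ : (k.+1 + k).+2 = (2 * k.+1).+1)%N; last by lia.
  rewrite !qprod1.
  rewrite !exprS; ring.
rewrite /jcoef.
rewrite (_ : (k + a.+2).+2 - k.+1 = a.+3)%N; last by lia.
rewrite (_ : (k + a.+2).+1 - k.+1 = a.+2)%N; last by lia.
rewrite (_ : (k + a.+2).+1 - k.+2 = a.+1)%N; last by lia.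
rewrite (_ : (k + a.+2).+1 - k = a.+3)%N; last by lia.
set m := (k + a.+2)%N.
rewrite (@qprodSr a.+3 m.+1); last by rewrite /m; lia.
rewrite (@qprodSl a.+1); last by rewrite /m; lia.
rewrite (@qprodSl a.+2); last by rewrite /m; lia.
rewrite (_ : 2 * m.+1 = (2 * m).+2)%N; last by lia.
rewrite (_ : (m.+1 + k.+1).+2 = (m + k).+4)%N; last by lia.
rewrite (_ : (m + k.+1).+2 = (m + k).+3)%N; last by lia.
rewrite (_ : (m + k.+2).+2 = (m + k).+4)%N; last by lia.
rewrite (@qprodSl (m + k).+2); last by rewrite /m; lia.
rewrite (@qprodSl (m + k).+3); last by rewrite /m; lia.
do 2 (rewrite (@qprodSr (m + k).+4); last by rewrite /m; lia).
set W := qprod _ _; set Z := qprod _ _.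
rewrite (_ : 2 * m = a.+2 + (m + k))%N; last by rewrite /m; lia.
rewrite (_ : (m.+1 + k.+2) = (m + k).+3)%N; last by lia.
rewrite -/m.
by rewrite !exprS !exprD !exprS; move: (q ^+ a) (q ^+ m) (q ^+ k) => u v w; ring.
Qed.

(* [cos ((2k+1)u) / cos u] as a polynomial in [x = -4 sin^2 u]. *)
Fixpoint coscheb (k : nat) : R :=
  if k is k1.+1 then
    if k1 is k2.+1 then (2 + x) * coscheb k1 - coscheb k2 else 1 + x
  else 1.

Arguments coscheb : simpl never.

Lemma coschebSS k : coscheb k.+2 = (2 + x) * coscheb k.+1 - coscheb k.
Proof. by []. Qed.

Lemma finite_triple_product M :
  \prod_(i < M) ((1 - q ^+ i.+1) * (1 + (2 + x) * q ^+ i.+1 + q ^+ (2 * i.+1))) =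
  \sum_(k < M.+1) jcoef M k * coscheb k * q ^+ 'C(k.+1, 2).
Proof.
elim: M => [|M IHM].
  by rewrite big_ord0 big_ord1 /jcoef !qprod_nil // expr0 !mulr1.
rewrite big_ord_recr /= {}IHM.
set m := M.+1; set e := fun k => jcoef M k * q ^+ 'C(k.+1, 2).
have eM k : (M < k)%N -> e k = 0 by move=> ?; rewrite /e jcoef_gt // mul0r.
(* The lower neighbour of index 0 is 0 itself, by the reflection of -1 to 0. *)
pose pre k := if k is k1.+1 then e k1 else e 0%N.
have erec k : (k <= m)%N -> jcoef m k * q ^+ 'C(k.+1, 2) =
    (1 - q ^+ m) * ((1 + q ^+ (2 * m)) * e k + q ^+ m * pre k + q ^+ m * e k.+1).
  rewrite {}/pre; case: k => [_|k le_km].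
    have -> : e 0%N = jcoef M 0 by rewrite /e mulr1.
    have -> : e 1%N = jcoef M 1 * q by rewrite /e expr1.
    rewrite jcoef_rec0 mulr1 (exprS q M.+1) -/m; ring.
  have Mk : (k + (M - k))%N = M by lia.
  have -> : jcoef m k.+1 = (1 - q ^+ m) *
      ((1 + q ^+ (2 * m)) * jcoef M k.+1 + q ^+ (M - k) * jcoef M k
       + q ^+ (m + k.+2) * jcoef M k.+2).
    by have := jcoef_recS (M - k) k; rewrite Mk.
  rewrite /e !triS; move: 'C(k.+1, 2) => T; rewrite !exprD.
  have -> : q ^+ m = q ^+ (M - k) * q ^+ k.+1.
    by rewrite -exprD; congr (q ^+ _); lia.
  ring.
(* The same reflection for [coscheb]: its value at -1 is 1. *)
pose prec k := if k is k1.+1 then coscheb k1 else 1.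
have precE k : coscheb k.+1 + prec k =
    (2 + x) * coscheb k.
  by rewrite /prec; case: k => [|k]; [rewrite /coscheb; ring | rewrite coschebSS; ring].
rewrite mulr_suml.
transitivity ((1 - q ^+ m) * (\sum_(k < M.+1) (1 + q ^+ (2 * m)) * e k * coscheb k
   + q ^+ m * \sum_(k < M.+1) e k * coscheb k.+1
   + q ^+ m * \sum_(k < M.+1) e k * prec k)).
  rewrite !mulr_sumr -!big_split mulr_sumr; apply: eq_bigr => k _; cbv beta.
  have -> : coscheb k.+1 = (2 + x) * coscheb k - prec k by rewrite -precE addrK.
  rewrite /e /=; ring.
under [RHS]eq_bigr => k _ do
  rewrite -mulrA [coscheb k * _]mulrC mulrA (erec k (ltn_ord k)) -mulrA.
rewrite -mulr_sumr; congr (_ * _).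
under [RHS]eq_bigr do rewrite 2!mulrDl -!(mulrA (q ^+ m)).
rewrite 2!big_split /= -!mulr_sumr -!addrA -!mulrDr; congr (_ + _ * _).
  by rewrite [RHS]big_ord_recr /= eM // mulr0 mul0r addr0.
(* The reflected term [e 0] sits in the [pre] sum on the right and in the [prec] sum on the left;
   the terms beyond [M] vanish by [eM]. *)
rewrite [X in _ = X + _]big_ord_recl [X in _ = _ + X]big_ord_recr /=.
rewrite [X in _ = _ + (X + _)]big_ord_recr /= (eM M.+1) // (eM m.+1) // !mul0r !addr0.
by rewrite [X in _ + X = _]big_ord_recl /= addrCA addrA.
Qed.
End FiniteTripleProduct.

(** The recurrence reads c_(k+2) - 2 c_(k+1) + c_k = x c_(k+1); on coefficients it becomes an
    instance of Pascal's rule. *)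
Lemma coef_coscheb (R : comNzRingType) k t :
  (coscheb ('X : {poly R}) k)`_t = 'C(k + t, 2 * t)%:R.
Proof.
suff [] : (coscheb ('X : {poly R}) k)`_t = 'C(k + t, 2 * t)%:R /\
          (coscheb ('X : {poly R}) k.+1)`_t = 'C(k.+1 + t, 2 * t)%:R by [].
elim: k t => [|k IHk] t.
  split; first by case: t => [|t]; rewrite coef1 // bin_small //; lia.
  case: t => [|[|t]]; rewrite /coscheb coefD coef1 coefX ?addr0 ?add0r //=.
  by rewrite bin_small //; lia.
split; first by case: (IHk t).
rewrite coschebSS coefB !mulrDl mul1r !coefD coefXM !(IHk _).2 (IHk _).1.
case: t => [|t] /=; first by rewrite muln0 !bin0; ring.
have -> : (2 * t.+1 = (2 * t).+2)%N by lia.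
rewrite !addSn !addnS.
rewrite !(binS _.+1 (2 * t).+1) (binS _ (2 * t).+1) !(binS _ (2 * t)) !natrD; ring.
Qed.


(** * Congruences modulo ['X^L] and the truncated triple product *)

Section TruncatedCongruence.
Variable R : comNzRingType.
Implicit Types (p r : {poly R}) (L : nat).

Definition congX L p r := forall i, (i < L)%N -> p`_i = r`_i.

Lemma congX_refl L p : congX L p p.
Proof. by []. Qed.

Lemma congX_sym L p r : congX L p r -> congX L r p.
Proof. by move=> pr i lt_iL; rewrite pr. Qed.

Lemma congX_trans L p2 p1 p3 : congX L p1 p2 -> congX L p2 p3 -> congX L p1 p3.
Proof. by move=> p12 p23 i lt_iL; rewrite p12 ?p23. Qed.

Lemma congX_mul L p1 p2 r1 r2 :
  congX L p1 p2 -> congX L r1 r2 -> congX L (p1 * r1) (p2 * r2).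
Proof.
move=> p12 r12 i lt_iL; rewrite !coefM; apply: eq_bigr => j _.
have le_ji : (j <= i)%N by rewrite -ltnS.
by rewrite p12 ?r12 //; apply: leq_ltn_trans lt_iL; rewrite ?leq_subr.
Qed.

Lemma congX_exp L p r n : congX L p r -> congX L (p ^+ n) (r ^+ n).
Proof.
by move=> pr; elim: n => [|n IHn]; rewrite ?expr0 // !exprS; apply: congX_mul.
Qed.

Lemma congX_sum L (I : Type) (s : seq I) (P : pred I) (F G : I -> {poly R}) :
  (forall i, P i -> congX L (F i) (G i)) ->
  congX L (\sum_(i <- s | P i) F i) (\sum_(i <- s | P i) G i).
Proof. by move=> FG j lt_jL; rewrite !coef_sum; apply: eq_bigr => i /FG ->. Qed.

Lemma congX_mulXn L n p r : congX L p r -> congX (L + n) (p * 'X^n) (r * 'X^n).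
Proof.
move=> pr i lt_i; rewrite !coefMXn; case: ltnP => // le_ni.
by apply: pr; rewrite ltn_subLR // addnC.
Qed.

Lemma qprod_cong1 a b : congX a (qprod ('X : {poly R}) a b) 1.
Proof.
rewrite /qprod big_nat_cond; elim/big_ind: _ => // [p r p1 r1|i].
  by rewrite -[1]mulr1; apply: congX_mul.
rewrite andbT => /andP[le_ai _] j lt_ja.
by rewrite coefB coefXn ltn_eqF ?subr0 //; apply: leq_trans le_ai.
Qed.

(** Every factor [1 - 'X^i] of the two products has [i >= M.+1 - k]. *)
Lemma jcoef_cong1 M k : (k <= M)%N -> congX (M.+1 - k) (jcoef ('X : {poly R}) M k) 1.
Proof.
move=> le_kM; rewrite /jcoef -[1]mulr1; apply: congX_mul; first exact: qprod_cong1.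
by move=> i lt_i; apply: (@qprod_cong1 (M + k).+2); lia.
Qed.

Lemma jcoefC M k : jcoef ('X%:P : {poly {poly R}}) M k = (jcoef ('X : {poly R}) M k)%:P.
Proof.
rewrite /jcoef /qprod rmorphM !rmorph_prod.
by congr (_ * _); apply: eq_bigr => i _; rewrite rmorphB rmorphXn rmorph1.
Qed.

(** The finite identity is read in [{poly {poly R}}], with [q] the inner and [x] the outer variable,
    and the coefficient of x^t is extracted. *)
Lemma triple_product_coef M t :
  congX M.+1
    (qprod 'X 1 M.+1 * (\prod_(i < M)
      (1 + (2 + 'X) * ('X : {poly R})%:P ^+ i.+1 + 'X%:P ^+ (2 * i.+1)))`_t)
    (\sum_(k < M.+1) 'C(k + t, 2 * t)%:R * 'X^('C(k.+1, 2))).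
Proof.
have := finite_triple_product ('X%:P : {poly {poly R}}) 'X M.
rewrite big_split /=.
have -> : \prod_(i < M) (1 - 'X%:P ^+ i.+1) = (qprod 'X 1 M.+1)%:P :> {poly {poly R}}.
  rewrite /qprod big_add1 big_mkord rmorph_prod; apply: eq_bigr => i _.
  by rewrite rmorphB rmorphXn rmorph1.
rewrite -coefCM => ->; rewrite coef_sum; apply: congX_sum => k _.
rewrite jcoefC -rmorphXn coefMC coefCM coef_coscheb.
rewrite [jcoef _ _ _ * _]mulrC -mulrA; apply: congX_mul => //.
rewrite -[X in congX _ _ X]mul1r.
have le_kM : (k <= M)%N by rewrite -ltnS.
move=> i lt_i; apply: (@congX_mulXn (M.+1 - k)); first exact: jcoef_cong1.
(* The precision [k] lost in [jcoef_cong1] is regained from the triangular power of ['X]. *)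
suff : (k <= 'C(k.+1, 2))%N by lia.
by rewrite binS bin1 leq_addl.
Qed.

End TruncatedCongruence.

(** * From increasing tuples to subsets, and the truncated series of [MO] *)

Lemma sum_increasing_tuples (V : nmodType) (M t : nat) (F : {set 'I_M.+1} -> V) :
  \sum_(s : t.-tuple 'I_M.+1 | path ltn 0 (map val s)) F [set i in s] =
  \sum_(S : {set 'I_M.+1} | (ord0 \notin S) && (#|S| == t)) F S.
Proof.
(* [h] lists a set in increasing order; the constant tuple is a dummy value for sets whose size is
   not [t]. *)
pose h (S : {set 'I_M.+1}) : t.-tuple 'I_M.+1 := insubd [tuple of nseq t ord0] (enum S).
have hE (S : {set 'I_M.+1}) : #|S| == t -> val (h S) = enum S.
  by move=> cardS; rewrite val_insubd -cardE cardS.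
have pathE (S : {set 'I_M.+1}) : path ltn 0 (map val (enum S)) = (ord0 \notin S).
  rewrite path_sortedE; last exact: ltn_trans.
  have -> : sorted ltn (map val (enum S)).
    rewrite sorted_map; apply: sorted_filter; first by move=> ? ? ?; apply: ltn_trans.
    by rewrite -sorted_map /= -enumT val_enum_ord iota_ltn_sorted.
  rewrite andbT; apply/allP/idP => [S_gt0 | S0 _ /mapP[i Si ->]].
    by apply/negP => S0; have /S_gt0 := map_f val (etrans (mem_enum _ _) S0).
  rewrite /= lt0n; apply: contra S0 => /eqP i0; rewrite mem_enum in Si.
  by rewrite (_ : ord0 = i) //; apply: val_inj.
rewrite [RHS](reindex_onto (fun s : t.-tuple _ => [set i in s]) h) /=; last first.
  move=> S /andP[_ cardS]; apply/setP => i.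
  by rewrite inE -[i \in h S]/(i \in val (h S)) hE // mem_enum.
apply: eq_bigl => s; apply/idP/idP => [s_path | /andP[/andP[s0 card_s] /eqP <-]]; last first.
  by rewrite hE // pathE.
have s_sorted : sorted ltn (map val s) by apply: path_sorted s_path.
have s_uniq : uniq s by rewrite -(map_inj_uniq val_inj) (sorted_uniq ltn_trans ltnn).
have card_s : #|[set i in s]| == t by rewrite cardsE (card_uniqP s_uniq) size_tuple.
have enum_s : enum [set i in s] = s.
  apply: (inj_map val_inj); apply: (irr_sorted_eq ltn_trans ltnn) => //.
    rewrite sorted_map; apply: sorted_filter; first by move=> ? ? ?; apply: ltn_trans.
    by rewrite -sorted_map /= -enumT val_enum_ord iota_ltn_sorted.
  move=> i; apply/mapP/mapP => -[j sj ->]; exists j => //.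
    by rewrite mem_enum inE in sj.
  by rewrite mem_enum inE.
rewrite card_s -pathE enum_s s_path /=; apply/eqP/val_inj.
by rewrite hE.
Qed.

Section Truncation.
Variable R : comNzRingType.
Implicit Types (L : nat) (f g : fps).

Definition fps_trunc L f : {poly R} := \poly_(i < L) (f i)%:~R.

Lemma fps_trunc_mul L f g :
  congX L (fps_trunc L (fps_mul f g)) (fps_trunc L f * fps_trunc L g).
Proof.
move=> i lt_iL; rewrite coef_poly lt_iL coefM rmorph_sum; apply: eq_bigr => j _.
have le_ji : (j <= i)%N by rewrite -ltnS.
by rewrite !coef_poly rmorphM !ifT //; apply: leq_ltn_trans lt_iL; rewrite ?leq_subr.
Qed.

Lemma fps_trunc_poly L (p : {poly int}) :
  congX L (fps_trunc L (fps_of_poly p)) (map_poly intr p).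
Proof. by move=> i lt_iL; rewrite coef_poly lt_iL coef_map. Qed.

Lemma fps_trunc_inv L (p : {poly int}) : p`_0 = 1 ->
  congX L (map_poly intr p * fps_trunc L (fps_inv (fps_of_poly p))) 1.
Proof.
move=> p0; apply: (@congX_trans _ _ (fps_trunc L (fps_of_poly p) *
                                     fps_trunc L (fps_inv (fps_of_poly p)))).
  by apply: congX_mul => //; apply/congX_sym/fps_trunc_poly.
apply: congX_trans (congX_sym (@fps_trunc_mul _ _ _)) _ => i lt_iL.
by rewrite coef_poly lt_iL fps_mulV // coef1; case: i {lt_iL}.
Qed.

(** Clearing the denominator gives a form without inverses, usable in a polynomial ring. *)
Lemma MO_term_trunc L a s : path ltn 0 s ->
  congX L (map_poly intr (MO_den a s) * fps_trunc L (MO_term a s))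
    ('X^(\sum_(m <- s) m)).
Proof.
move=> s_path; have den0 := MO_den_coef0 a s_path.
apply: (@congX_trans _ _ (map_poly intr (MO_den a s) *
   ('X^(\sum_(m <- s) m) * fps_trunc L (fps_inv (fps_of_poly (MO_den a s)))))).
  apply: congX_mul => //; apply: congX_trans (@fps_trunc_mul _ _ _) _.
  apply: congX_mul => //; apply: congX_trans (@fps_trunc_poly _ _) _.
  by rewrite map_polyXn.
rewrite mulrCA -[X in congX _ _ X]mulr1; apply: congX_mul => //.
exact: fps_trunc_inv.
Qed.

Definition MO_factor (a : int) m : {poly R} := 1 + a%:~R *: 'X^m + 'X^(2 * m).

Lemma map_MO_den a s : map_poly intr (MO_den a s) = \prod_(m <- s) MO_factor a m.
Proof.
rewrite rmorph_prod; apply: eq_bigr => m _.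
by rewrite !rmorphD /= map_polyZ !map_polyXn rmorph1.
Qed.

(** Each factor on the right is [MO_factor] plus x q^i. Choosing the set S of indices where x q^i is
    taken gives q^(sum of S) times the factors outside S, which is the full product of factors times
    the term of S. *)
Lemma MO_upto_trunc L a t M :
  congX L
    (\prod_(i < M) MO_factor a i.+1 * fps_trunc L (MO_upto a t M))
    (\prod_(i < M) (1 + (a%:~R + 'X) * ('X : {poly R})%:P ^+ i.+1 + 'X%:P ^+ (2 * i.+1)))`_t.
Proof.
(* Index 0 of ['I_M.+1] is not an admissible part: it gets weight 1 in [w], and 0 in [f] below,
   which kills the subsets containing it. *)
pose w m := if m is m.+1 then MO_factor a m.+1 else 1.
pose G (S : {set 'I_M.+1}) := 'X^(\sum_(i in S) i) * \prod_(i in ~: S) w i.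
have -> : (\prod_(i < M) (1 + (a%:~R + 'X) * ('X : {poly R})%:P ^+ i.+1
                              + 'X%:P ^+ (2 * i.+1)))`_t =
    \sum_(S : {set 'I_M.+1} | (ord0 \notin S) && (#|S| == t)) G S.
  pose f (i : 'I_M.+1) := if i == ord0 then 0 else ('X^i : {poly R})%:P * 'X.
  pose g (i : 'I_M.+1) := (w i)%:P.
  transitivity ((\prod_i (f i + g i))`_t).
    congr (_`_t); congr polyseq.
    rewrite big_ord_recl /f /g /= add0r polyC1 mul1r; apply: eq_bigr => i _.
    rewrite /MO_factor !rmorphD /= -mul_polyC !rmorphM /= !rmorphXn /= rmorph1.
    by rewrite !rmorph_int; ring.
  rewrite bigA_distr coef_sum [RHS]big_mkcond; apply: eq_bigr => S _.
  case: (boolP (ord0 \in S)) => [S0 | S0] /=.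
    by rewrite (bigD1 ord0) //= S0 /f eqxx mul0r coef0.
  have -> : \prod_i (if i \in S then f i else g i) = (G S)%:P * 'X^#|S|.
    rewrite (bigID (mem S)) /= (eq_bigr f); last by move=> i ->.
    rewrite [X in _ * X](eq_bigr g); last by move=> i /negPf->.
    rewrite (eq_bigr (fun i : 'I_M.+1 => ('X^i)%:P * 'X)); last first.
      by move=> i Si; rewrite /f ifN //; apply: contraNneq S0 => <-.
    rewrite big_split /= prodr_const /G -prodrXr rmorphM !rmorph_prod mulrAC.
    by congr (_ * _ * _); apply: eq_bigl => i; rewrite inE.
  by rewrite coefCM coefXn eq_sym; case: eqP; rewrite ?mulr1 ?mulr0.
rewrite -sum_increasing_tuples.
have -> : fps_trunc L (MO_upto a t M) =
    \sum_(s : t.-tuple 'I_M.+1 | path ltn 0 (map val s)) fps_trunc L (MO_term a (map val s)).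
  apply/polyP => i; rewrite coef_poly coef_sum; case: ifP => lt_iL; last first.
    by rewrite big1 // => s _; rewrite coef_poly lt_iL.
  by rewrite rmorph_sum; apply: eq_bigr => s _; rewrite coef_poly lt_iL.
rewrite mulr_sumr; apply: congX_sum => s s_path.
have s_uniq : uniq s.
  rewrite -(map_inj_uniq val_inj).
  exact: (sorted_uniq ltn_trans ltnn (path_sorted s_path)).
have s_w : {in s, forall i : 'I_M.+1, MO_factor a i = w i}.
  move=> i si; have := s_path; rewrite path_sortedE; last exact: ltn_trans.
  by case/andP => /allP /(_ _ (map_f val si)) /= i_gt0 _; case: (nat_of_ord i) i_gt0.
have -> : \prod_(i < M) MO_factor a i.+1 =
    \prod_(m <- map val s) MO_factor a m * \prod_(i in ~: [set i in s]) w i.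
  transitivity (\prod_(i < M.+1) w i).
    by rewrite big_ord_recl mul1r.
  rewrite (bigID (mem s)) /= -big_uniq // big_map.
  congr (_ * _); first by rewrite !big_seq; apply: eq_bigr => i /s_w.
  by apply: eq_bigl => i; rewrite !inE.
rewrite -map_MO_den mulrAC /G.
apply: congX_mul => //; apply: congX_trans (@MO_term_trunc L a _ s_path) _.
rewrite big_map big_uniq //= (eq_bigl (mem [set i in s])) // => i.
by rewrite /= inE.
Qed.

End Truncation.

(** * The series psi and its 3-dissection *)

Lemma tri_double k : ('C(k.+1, 2) * 2 = k * k.+1)%N.
Proof.
have : ~~ odd (k * k.+1) by rewrite oddM /= andbN.
by rewrite bin2 /= mulnC; lia.
Qed.

Section Psi.
Variable R : comNzRingType.

Definition psi K : {poly R} := \sum_(k < K) 'X^('C(k.+1, 2)).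

Lemma congX_psi K K' : (K <= K')%N -> congX K (psi K') (psi K).
Proof.
move=> le_KK' i lt_iK; rewrite /psi -!(big_mkord xpredT (fun k => 'X^('C(k.+1, 2)))).
rewrite (big_cat_nat (leq0n K) le_KK') //= coefD [X in _ + X]coef_sum.
rewrite [X in _ + X]big_nat_cond [X in _ + X]big1 ?addr0 // => k /andP[/andP[le_Kk _] _].
rewrite coefXn ltn_eqF //; apply: leq_trans lt_iK (leq_trans le_Kk _).
by rewrite binS bin1 leq_addl.
Qed.

(** [psiE], the triple product at exponent 0, trades [psi] for the product of all factors;
    [MO_upto_trunc] then leads to the triple product at [t]. *)
Lemma psi_mul_MO t M :
  congX M.+1 (psi M.+1 * fps_trunc R M.+1 (MO_upto 2 t M))
    (\sum_(k < M.+1) 'C(k + t, 2 * t)%:R * 'X^('C(k.+1, 2))).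
Proof.
have psiE : congX M.+1 (qprod 'X 1 M.+1 * \prod_(i < M) MO_factor R 2 i.+1) (psi M.+1).
  have := @triple_product_coef R M 0; rewrite coef0_prod.
  rewrite (eq_bigr (fun i : 'I_M => MO_factor R 2 i.+1)) => [|i _]; last first.
    rewrite -!rmorphXn !coefD coef1 coefC mulrDl coefD coefXM addr0 mulr2n mulrDl.
    by rewrite /MO_factor scaler_int coefD !mul1r !coefC -mulr2n.
  congr (congX _ _ _); apply: eq_bigr => k _.
  by rewrite muln0 bin0 mul1r.
apply: congX_trans (congX_mul (congX_sym psiE) (@congX_refl _ _ _)) _.
rewrite -mulrA.
apply: congX_trans (congX_mul (@congX_refl _ _ _) (@MO_upto_trunc _ _ _ _ _)) _.
exact: triple_product_coef.
Qed.

(** T_k is divisible by 3 when k is 0 or 2 modulo 3, while T_(3k+1) = 9 T_k + 1. *)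
Lemma psi_dissection K :
  {A : {poly R} | psi (3 * K) = A \Po 'X^3 + 'X * ((psi K \Po 'X^3) \Po 'X^3)}.
Proof.
elim: K => [|K [A AE]].
  by exists 0; rewrite /psi !big_ord0 !comp_poly0 mulr0 addr0.
rewrite /psi (_ : 3 * K.+1 = (3 * K).+3)%N; last by lia.
rewrite !big_ord_recr /= -!/(psi _) AE.
have dvdT k : (3 %| k * k.+1)%N -> (3 %| 'C(k.+1, 2))%N.
  by rewrite -tri_double mulnC Gauss_dvdr.
have T0 : (3 %| 'C((3 * K).+1, 2))%N by apply: dvdT; rewrite -mulnA dvdn_mulr.
have T2 : (3 %| 'C((3 * K).+3, 2))%N.
  by apply: dvdT; rewrite dvdn_mull //; lia.
have T1 : 'C((3 * K).+2, 2) = (9 * 'C(K.+1, 2)).+1.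
  have := tri_double K; have := tri_double (3 * K).+1; nia.
exists (A + 'X^('C((3 * K).+1, 2) %/ 3) + 'X^('C((3 * K).+3, 2) %/ 3)).
rewrite !comp_polyD !comp_Xn_poly -!exprM comp_Xn_poly -exprM T1.
rewrite (_ : (9 * 'C(K.+1, 2)).+1 = 1 + 3 * (3 * 'C(K.+1, 2)))%N; last by lia.
rewrite (exprD _ 1).
have E n : (3 %| n)%N -> 'X^n = 'X^(3 * (n %/ 3)) :> {poly R}.
  by move=> n3; rewrite mulnC divnK.
rewrite (E _ T0) (E _ T2). ring.
Qed.

End Psi.

(** * Frobenius over F_p and binomial coefficients modulo p *)

Lemma Frobenius_poly p e (f : {poly 'F_p}) : prime p -> f ^+ (p ^ e) = f \Po 'X^(p ^ e).
Proof.
move=> p_pr; have charFp := pchar_Fp p_pr.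
have pF : [pchar {poly 'F_p}].-nat (p ^ e)%N.
  by rewrite pnatX; apply/orP; left; rewrite pnatE // pchar_poly.
elim/poly_ind: f => [|f c IHf].
  by rewrite comp_poly0 expr0n expn_eq0 (gtn_eqF (prime_gt0 p_pr)).
rewrite exprDn_pchar // exprMn IHf comp_polyD comp_polyM comp_polyX comp_polyC.
rewrite -polyC_exp; congr (_ + _%:P).
(* The constant term is fixed, by Fermat's little theorem. *)
by elim: e {pF IHf} => // e IHe; rewrite expnS exprM -[X in c ^+ X](card_Fp p_pr) expf_card.
Qed.

(** A weak form of Lucas' theorem. Comparing coefficients in (1+X)^(q+k) = (1+X^q)(1+X)^k lowers [n]
    by [q] and keeps both residues, down to [n < q], where the binomial is zero. *)
Lemma bin_modn_lt p e n m : prime p -> (n %% p ^ e < m %% p ^ e)%N -> (p %| 'C(n, m))%N.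
Proof.
move=> p_pr; set q := (p ^ e)%N => lt_nm.
have q_gt0 : (0 < q)%N by rewrite expn_gt0 prime_gt0.
have coef_1X k i : ((1 + 'X : {poly 'F_p}) ^+ k)`_i = 'C(k, i)%:R.
  elim: k i => [|k IHk] i; first by rewrite coef1 bin0n eq_sym.
  rewrite exprSr mulrDr mulr1 coefD coefMX !IHk.
  by case: i => [|i] /=; rewrite ?bin0 ?addr0 // binS natrD.
have binD k i : 'C(q + k, i)%:R =
    'C(k, i)%:R + (if (i < q)%N then 0 else 'C(k, i - q)%:R) :> 'F_p.
  rewrite -coef_1X exprD Frobenius_poly // comp_polyD comp_polyC comp_polyX.
  by rewrite mulrDl mul1r coefD coefXnM !coef_1X.
rewrite (dvdn_pcharf (pchar_Fp p_pr)) (divn_eq n q).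
elim: (n %/ q)%N m lt_nm => [|a IHa] m lt_nm.
  by rewrite bin_small //; apply: leq_trans lt_nm (leq_mod _ _).
rewrite mulSn -addnA binD (eqP (IHa m lt_nm)) add0r; case: ltnP => // le_qm.
by apply: IHa; rewrite -(modnDr (m - q)) subnK.
Qed.

(** The lower entry is 8 modulo 9, which forces k + 4 to be 8 too; then k is 4 modulo 9 and 2 T_k is
    20 modulo 27. *)
Lemma bin_tri_mod9_4 J k :
  ~~ (3 %| 'C(k + (9 * J + 4), 2 * (9 * J + 4)))%N -> ('C(k.+1, 2) %% 27 = 10)%N.
Proof.
move=> ndvd; have : ~~ ((k + (9 * J + 4)) %% 3 ^ 2 < (2 * (9 * J + 4)) %% 3 ^ 2)%N.
  by apply: contra ndvd; apply: bin_modn_lt.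
rewrite -leqNgt => le_mod.
have [m ->] : exists m, k = (9 * m + 4)%N by exists (k %/ 9)%N; lia.
have := tri_double (9 * m + 4); move: 'C(_, 2) => T.
have -> : ((9 * m + 4) * (9 * m + 4).+1 = 27 * (3 * (m * m) + 3 * m) + 20)%N by nia.
lia.
Qed.

(** The lower entry is 5 modulo 9 and 2 modulo 3, so k + 7 is 5 or 8 modulo 9; in both cases 2 T_k
    is 2 modulo 27. *)
Lemma bin_tri_mod9_7 J k :
  ~~ (3 %| 'C(k + (9 * J + 7), 2 * (9 * J + 7)))%N -> ('C(k.+1, 2) %% 27 = 1)%N.
Proof.
move=> ndvd; have : ~~ ((k + (9 * J + 7)) %% 3 ^ 2 < (2 * (9 * J + 7)) %% 3 ^ 2)%N.
  by apply: contra ndvd; apply: bin_modn_lt.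
have : ~~ ((k + (9 * J + 7)) %% 3 ^ 1 < (2 * (9 * J + 7)) %% 3 ^ 1)%N.
  by apply: contra ndvd; apply: bin_modn_lt.
rewrite -!leqNgt => le_mod3 le_mod9.
have [m [-> | ->]] : exists m, k = (9 * m + 7)%N \/ k = (9 * m + 1)%N.
  by exists (k %/ 9)%N; lia.
- have := tri_double (9 * m + 7); move: 'C(_, 2) => T.
  have -> : ((9 * m + 7) * (9 * m + 7).+1 = 27 * (3 * (m * m) + 5 * m + 2) + 2)%N by nia.
  lia.
have := tri_double (9 * m + 1); move: 'C(_, 2) => T.
have -> : ((9 * m + 1) * (9 * m + 1).+1 = 27 * (3 * (m * m) + m) + 2)%N by nia.
lia.
Qed.

(** * Powers of psi over F_3 and division by psi *)

Section ModThree.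
Notation F3 := 'F_3.
Implicit Types (f : {poly F3}).

Lemma cubeE f : f ^+ 3 = f \Po 'X^3.
Proof. by have := @Frobenius_poly 3 1 f isT; rewrite expn1. Qed.

(** Over ['F_3] a cube is a polynomial in ['X^3], so exponents congruent to 2 modulo 3 come only
    from the last summand. *)
Lemma coef_dissected f0 f1 f2 m i :
  (f0 ^+ 3 + 'X * f1 ^+ 3 *+ m + 'X^2 * f2 ^+ 3)`_(3 * i + 2) = f2`_i.
Proof.
rewrite !coefD coefMn coefXM coefXnM (cubeE f0) (cubeE f1) (cubeE f2) !coef_comp_poly_Xn //.
have -> : (3 %| 3 * i + 2)%N = false by apply/negbTE; lia.
have -> : (3 %| (3 * i + 2).-1)%N = false by apply/negbTE; lia.
by rewrite addnK dvdn_mulr // mulKn // addn2 /= mul0rn !add0r.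
Qed.

Lemma psi_dissection3 K :
  {A : {poly F3} | psi F3 (3 * K) = A ^+ 3 + 'X * (psi F3 K ^+ 3) ^+ 3}.
Proof.
case: (psi_dissection F3 K) => A AE; exists A.
by rewrite (cubeE A) (cubeE (_ ^+ 3)) (cubeE (psi _ _)).
Qed.

Lemma coef_psi_exp K e i : (i < K)%N ->
  (psi F3 (3 * K) ^+ (3 * e + 2))`_(3 * i + 2) = (psi F3 (3 * K) ^+ (e + 6))`_i.
Proof.
move=> lt_iK; have [A AE] := psi_dissection3 K.
set f := psi F3 (3 * K) in AE *; set g := psi F3 K in AE *.
rewrite exprD [(3 * e)%N]mulnC exprM {2}AE.
have -> : (f ^+ e) ^+ 3 * (A ^+ 3 + 'X * (g ^+ 3) ^+ 3) ^+ 2 =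
    (f ^+ e) ^+ 3 * (A ^+ 2) ^+ 3 + 'X * (f ^+ e * A * g ^+ 3) ^+ 3 *+ 2
    + 'X^2 * (f ^+ e * g ^+ 6) ^+ 3 by ring.
rewrite -exprMn coef_dissected exprD.
(* [g] and [f] agree below degree [K], so g^6 may be replaced by f^6 in the coefficient of index
   [i]. *)
by apply: (congX_mul (L := K)) => //; apply/congX_exp/congX_sym/congX_psi; lia.
Qed.

Lemma coef_psi_exp10 K i : (psi F3 (3 * K) ^+ 10)`_(3 * i + 2) = 0.
Proof.
have [A AE] := psi_dissection3 K.
set f := psi F3 (3 * K) in AE *; set g := psi F3 K in AE *.
rewrite (exprD _ 9 1) expr1 {2}AE (exprM _ 3 3).
have -> : (f ^+ 3) ^+ 3 * (A ^+ 3 + 'X * (g ^+ 3) ^+ 3) =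
   (f ^+ 3 * A) ^+ 3 + 'X * (f ^+ 3 * g ^+ 3) ^+ 3 *+ 1 + 'X^2 * 0 ^+ 3 by ring.
by rewrite coef_dissected coef0.
Qed.

Lemma coef_psi_exp26 K i : (i < K)%N -> (i %% 27 = 26)%N -> (psi F3 (3 * K) ^+ 26)`_i = 0.
Proof.
move=> lt_iK i26; have [j ij] : exists j, i = (27 * j + 26)%N by exists (i %/ 27)%N; lia.
(* In base 3 the residue 26 is 222: each extraction strips one digit 2, while the power of psi goes
   from 26 = 3*8+2 to 14 = 3*4+2, then to 10. *)
have -> : i = (3 * (9 * j + 8) + 2)%N by lia.
rewrite (@coef_psi_exp K 8); last by lia.
have -> : (9 * j + 8 = 3 * (3 * j + 2) + 2)%N by lia.
by rewrite (@coef_psi_exp K 4) ?coef_psi_exp10 //; lia.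
Qed.

(** Multiplying by psi^26 turns psi v = num into psi(q^27) v = num psi^26. At exponent [n] the right
    side is zero: an exponent of [num] is [a] modulo 27, which leaves 26 modulo 27 for psi^26. *)
Lemma psi_quotient_coef0 L (v num : {poly F3}) a :
    congX L (psi F3 L * v) num ->
    (forall i, num`_i != 0 -> (i %% 27 = a %% 27)%N) ->
  forall n, (n < L)%N -> ((n.+1 %% 27) = a %% 27)%N -> v`_n = 0.
Proof.
move=> v_num num_supp; set f := psi F3 (3 * L).
have fv : congX L ((f \Po 'X^27) * v) (num * f ^+ 26).
  rewrite -[27%N]/(3 ^ 3)%N -(Frobenius_poly _ _ (isT : prime 3)) (exprD _ 1 26) expr1.
  rewrite mulrAC; apply: congX_mul => //; apply: congX_trans v_num.
  by apply: congX_mul => //; apply: congX_psi; lia.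
elim/ltn_ind => n IHn lt_nL na; have := fv n lt_nL; rewrite !coefM.
rewrite [RHS]big1 => [|i _]; last first.
  have [->|/num_supp ia] := eqVneq num`_i 0; first by rewrite mul0r.
  have le_in : (i <= n)%N by rewrite -ltnS.
  by rewrite coef_psi_exp26 ?mulr0 //; lia.
(* On the left, the terms after the first involve [v] at [n] minus a positive multiple of 27, zero
   by induction. *)
rewrite big_ord_recl big1 => [|i _]; last first.
  rewrite coef_comp_poly_Xn //; case: ifP => [i27|_]; last by rewrite mul0r.
  rewrite lift0 in i27 *; have lt_in := ltn_ord i.
  by rewrite IHn ?mulr0 //; lia.
rewrite coef_comp_poly_Xn //= subn0 addr0 div0n.
have -> : f`_0 = 1.
  have L_gt0 : (0 < 3 * L)%N by lia.
  rewrite (@congX_psi F3 1 _ L_gt0) // /psi big_ord1 expr0 coef1 //.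
by rewrite mul1r.
Qed.

End ModThree.

(** [a] is the common residue modulo 27 of the exponents in the numerator; division by psi yields
    vanishing at the residue of [a - 1]. *)
Lemma MO2_mod3 t a n : ((n.+1 %% 27) = a %% 27)%N ->
    (forall k, ~~ (3 %| 'C(k + t, 2 * t)) -> 'C(k.+1, 2) %% 27 = a %% 27)%N ->
  (MO 2 t n = 0 %[mod 3])%Z.
Proof.
move=> na tri_a; have F3 := pchar_Fp (isT : prime 3).
apply/eqP; rewrite eqz_mod_dvd subr0 (dvdz_pcharf F3).
(* [MO 2 t n] is by definition read off the sum cut at [M = n], so truncation at [n.+1] suffices. *)
have <- : (fps_trunc 'F_3 n.+1 (MO_upto 2 t n))`_n = (MO 2 t n)%:~R.
  by rewrite coef_poly ltnSn.
apply/eqP; apply: (psi_quotient_coef0 (@psi_mul_MO _ t n) _ (ltnSn n) na) => i.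
apply: contraNeq => ia; rewrite coef_sum big1 // => k _.
rewrite mulr_natl coefMn coefXn; case: eqP => [ik|_]; last by rewrite mul0rn.
by apply/eqP; rewrite -(dvdn_pcharf F3); apply: contraNT ia => /tri_a; rewrite -ik => ->.
Qed.

Theorem theorem5p1 (J N : nat) :
  (MO 2 (9 * J + 4) (27 * N + 9) = 0 %[mod 3])%Z /\
  (MO 2 (9 * J + 7) (27 * N) = 0 %[mod 3])%Z.
Proof.
split.
  by apply: (@MO2_mod3 _ 10) => [|k /bin_tri_mod9_4]; lia.
by apply: (@MO2_mod3 _ 1) => [|k /bin_tri_mod9_7]; lia.
Qed.
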